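(* Let $q\ge 1$ be a positive integer, let $\beta$ be an arbitrary real number, and let $x$ be a nonzero real number. Then the following reduction formula holds true: $$\left.\frac{\partial \mathrm{Ei}_{\alpha,\beta}(x)}{\partial\alpha}\right|_{\alpha=1/q}=-\sum_{h=0}^{q-1}\frac{x^{-h}}{\Gamma\left(\beta-\frac hq\right)}\,Q\left(\beta-\frac hq,\;x^q\right).$$
   Context: The integral Mittag-Leffler function is $\mathrm{Ei}_{\alpha,\beta}(x)=\sum_{k=1}^{\infty}\frac{x^k}{k\,\Gamma(\alpha k+\beta)}$, so that $\frac{\partial \mathrm{Ei}_{\alpha,\beta}(x)}{\partial\alpha}=-\sum_{k=1}^\infty\frac{\psi(\alpha k+\beta)}{\Gamma(\alpha k+\beta)}x^k$, where $\psi(z)=\Gamma'(z)/\Gamma(z)$ is the digamma function. The function $Q$ is defined by $$Q(a,x):=\sum_{k=1}^\infty\frac{x^k}{(a)_k}\psi(k+a)=e^x\left[x^{1-a}\psi(a)\gamma(a,x)+\frac{x}{a^2}\,{}_2F_2\left(a,a;a+1,a+1;-x\right)\right],$$ where $(a)_k=a(a+1)\cdots(a+k-1)$ is the Pochhammer symbol, $\gamma(a,x)=\int_0^x e^{-t}t^{a-1}dt$ is the lower incomplete gamma function, and ${}_2F_2$ is the generalized hypergeometric function.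
   Formalization: When β − h/q is a nonpositive integer, Q(β − h/q, x^q)/Γ(β − h/q) is undefined as printed (the Pochhammer symbols vanish); there it is read as the limit of Q(b, x^q)/Γ(b) as b tends to β − h/q. *)

(* Defs.v *)
From HB Require Import structures.
From mathcomp Require Import all_boot all_order all_algebra.
From mathcomp Require Import all_classical all_reals all_analysis.
Import Order.TTheory GRing.Theory Num.Theory.
Import numFieldNormedType.Exports.

Set Implicit Arguments.
Unset Strict Implicit.
Unset Printing Implicit Defensive.

Local Open Scope classical_set_scope.
Local Open Scope ring_scope.

Definition pochhammer (R : realType) (a : R) (k : nat) : R :=
  \prod_(0 <= i < k) (a + i%:R).

Definition euler_integral (R : realType) (a : R) : R :=
  \int[lebesgue_measure]_(t in `]0, +oo[) (expR (- t) * t `^ (a - 1)).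

(* For [a <= 0] the integral is continued by [Gamma a = Gamma (a + n) / (a)_n],
   with [n] the least integer such that [1 <= a + n].  At a pole (a = 0, -1,
   -2, ...) the denominator vanishes, hence [Gamma a = 0] and
   [(Gamma a)^-1 = 0], which is the value there of the entire function
   1/Gamma. *)
Definition Gamma (R : realType) (a : R) : R :=
  if 0 < a then euler_integral a
  else let n := (`|Num.floor a|%N).+1 in
       euler_integral (a + n%:R) / pochhammer a n.

Definition Gamma_pole (R : realType) (a : R) : bool :=
  (a \is a Num.int) && (a <= 0).

Definition digamma (R : realType) (a : R) : R := derive1 (@Gamma R) a / Gamma a.

Definition Ei (R : realType) (alpha beta x : R) : R :=
  limn (fun n => \sum_(1 <= k < n)
    x ^+ k / (k%:R * Gamma (alpha * k%:R + beta))).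

Definition Q (R : realType) (a x : R) : R :=
  limn (fun n => \sum_(1 <= k < n)
    x ^+ k / pochhammer a k * digamma (k%:R + a)).

(* The quotient Q(a, x) / Gamma(a).  At a pole of Gamma it is an indeterminate
   form ((a)_k = 0 for large k, and digamma has a pole at k + a for small k)
   with a removable singularity; it then denotes its limit. *)
Definition Q_div_Gamma (R : realType) (a x : R) : R :=
  if Gamma_pole a then lim (Q b x / Gamma b @[b --> a^'])
  else Q a x / Gamma a.

(* Main.v *)
Require Import Defs.
From mathcomp Require Import all_boot all_order all_algebra.
From mathcomp Require Import all_classical all_reals all_analysis.
From mathcomp Require Import measurable_realfun zify ring lra.
Import Order.TTheory GRing.Theory Num.Theory.
Import numFieldNormedType.Exports.

(** Let [g = 1 / Gamma], an entire function.  Termwise differentiation in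
    [alpha] of the series [\sum_k x ^ k * g (alpha * k + beta) / k] gives
    [\sum_k x ^ k * g' (alpha * k + beta)].  At [alpha = 1 / q], split the
    indices according to their residue modulo [q], as [m = q * k - h] with
    [k >= 1] and [0 <= h < q].  The sum becomes the sum over [h] of
    [x ^ (- h) * \sum_k (x ^ q) ^ k * g' (k + beta - h / q)].  Off the poles
    [digamma / Gamma = - g'] and [g a = (a)_k * g (a + k)], so the inner series
    at [a = beta - h / q] is [- Q (a, x ^ q) / Gamma a]; it is continuous in
    [a], which gives the limit that stands for this quotient at a pole.

    The work lies in the analysis of [g].  Partial integration gives the
    functional equation of the Euler integral ([euler_integralS]), and its
    division-free form [g z = z * g (z + 1)] holds everywhere ([rGammaS]).
    Differentiation under the integral sign, needed only for large arguments,
    and this recursion make [g] continuously differentiable on the whole line.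
    Integrating over one unit interval far to the right bounds the Euler
    integral from below by any exponential ([euler_integral_ge]); with the
    bound [a + 1] of the digamma function this makes [g] and [g'] decay faster
    than any exponential ([rGamma_decay], [drGamma_decay]).  Hence all the
    series above are dominated by geometric ones, locally uniformly, and
    Tannery's theorem ([cvg_lim_sum_dominated]) justifies both the termwise
    derivative ([is_derive_Ei]) and the limit at the poles ([Q_div_GammaE]).
    The regrouping is [sum_drGamma_series]. *)

Set Implicit Arguments.
Unset Strict Implicit.
Unset Printing Implicit Defensive.

Local Open Scope classical_set_scope.
Local Open Scope ring_scope.

(** * The functional equation of the Euler integral *)

Section EulerIntegral.
Context {R : realType}.
Implicit Types a b s t : R.
Local Notation mu := lebesgue_measure.
Local Notation D := (`]0, +oo[%classic : set R).

Definition gamma_kernel b t : R := expR (- t) * t `^ b.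

Lemma gamma_kernel_ge0 b t : 0 <= gamma_kernel b t.
Proof. by rewrite mulr_ge0 ?expR_ge0 ?powR_ge0. Qed.

Lemma measurable_gamma_kernel b (A : set R) : measurable_fun A (gamma_kernel b).
Proof.
apply: measurable_funTS; apply: measurable_funM; last exact: measurable_powR.
by apply: measurableT_comp => //; exact: oppr_measurable.
Qed.

Lemma is_derive_gamma_kernel a t : 0 < t ->
  is_derive t 1 (gamma_kernel a) (a * gamma_kernel (a - 1) t - gamma_kernel a t).
Proof.
move=> t0; have d1 := is_derive1_powR a t0.
have d2 : is_derive t 1 (fun t : R => expR (- t)) (- expR (- t)).
  apply: is_derive_eq; by rewrite mulrN1.
have d := is_deriveM d2 d1.
apply: is_derive_eq.
by rewrite /gamma_kernel /GRing.scale /=; ring.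
Qed.

Lemma continuous_gamma_kernel a t : 0 < t -> {for t, continuous (gamma_kernel a)}.
Proof.
move=> t0; apply: differentiable_continuous; apply/derivable1_diffP.
by apply: ex_derive; exact: is_derive_gamma_kernel.
Qed.

Lemma gamma_kernel_cvg0 a : 0 < a -> gamma_kernel a t @[t --> 0^'+] --> 0.
Proof.
move=> a0; rewrite -[X in _ --> X](mulr0 (expR (- 0))).
apply: cvgM; last exact: powR_cvg0.
apply: cvg_at_right_filter; apply: continuous_comp; last exact: continuous_expR.
exact: opp_continuous.
Qed.

(** The factor [t `^ a] costs only half of the exponent: [ln u <= u - 1] at
    [u = t / (2 a)], where the slope of the bound on [a * ln t] is [1 / 2]. *)
Lemma gamma_kernel_le a t : 0 < a -> 0 < t ->
  gamma_kernel a t <= expR (a * ln (a *+ 2)) * expR (- (t / 2)).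
Proof.
move=> a0 t0; rewrite /gamma_kernel /powR gt_eqF// -!expRD ler_expR.
have a20 : 0 < a *+ 2 by rewrite mulrn_wgt0.
have : ln (t / (a *+ 2)) <= t / (a *+ 2) - 1.
  rewrite -{1}[t / _](subrKC 1); apply: le_ln1Dx.
  by rewrite ltrBrDl subrr divr_gt0.
rewrite ln_div ?posrE// => h.
have : a * (ln t - ln (a *+ 2)) <= a * (t / (a *+ 2) - 1) by rewrite ler_pM2l.
have -> : a * (t / (a *+ 2) - 1) = t / 2 - a by field; rewrite gt_eqF.
lra.
Qed.

Lemma gamma_kernel_cvgy a : 0 < a -> gamma_kernel a t @[t --> +oo] --> 0.
Proof.
move=> a0.
have h : expR (a * ln (a *+ 2)) * expR (- (t / 2)) @[t --> +oo] --> (0 : R).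
  rewrite -[X in _ --> X](mulr0 (expR (a * ln (a *+ 2)))); apply: cvgMr.
  apply: (@cvg_comp _ _ _ (fun t : R => t / 2) (fun t : R => expR (- t)) _ (@pinfty_nbhs R)).
    exact: gt0_cvgMly.
  exact: cvgr_expR.
apply: (squeeze_cvgr _ (cvg_cst 0) h).
near=> t; rewrite gamma_kernel_ge0 gamma_kernel_le//.
Unshelve. all: end_near. Qed.

(** Partial integration needs a kernel continuous up to the end points, which
    fails at 0 for [b < 0]; these segments stay away from 0 and from infinity
    and exhaust the half-line. *)
Let S n : set R := `[n.+1%:R^-1, n.+2%:R].

Let S_gt0 n t : S n t -> 0 < t.
Proof.
by rewrite /S/= in_itv/= => /andP[+ _]; apply: lt_le_trans; rewrite invr_gt0.
Qed.

Let S_lt n : n.+1%:R^-1 < n.+2%:R :> R.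
Proof. by rewrite (@le_lt_trans _ _ 1) ?invf_le1 ?ler1n ?ltr1n. Qed.

Let nondecreasing_S : nondecreasing_seq S.
Proof.
move=> m n mn; rewrite subsetEset; apply: subset_itv; rewrite bnd_simp.
  by rewrite lef_pV2 ?posrE// ler_nat.
by rewrite ler_nat.
Qed.

Let bigcup_S : \bigcup_n S n = D.
Proof.
apply/seteqP; split => [t [n _ /S_gt0]|t]; rewrite /= in_itv/= andbT// => t0.
exists (maxn (Num.truncn t) (Num.truncn t^-1)) => //.
rewrite /S /= in_itv/= invf_ple ?posrE//; apply/andP; split.
  by rewrite ltW// (lt_le_trans (truncnS_gt _))// ler_nat ltnS leq_maxr.
by rewrite ltW// (lt_le_trans (truncnS_gt _))// ler_nat ltnS leqW// leq_maxl.
Qed.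

Let within_gamma_kernel a n : {within S n, continuous (gamma_kernel a)}.
Proof.
apply: continuous_in_subspaceT => t /set_mem /S_gt0.
exact: continuous_gamma_kernel.
Qed.

Let integrable_gamma_kernel_S a n : mu.-integrable (S n) (EFin \o gamma_kernel a).
Proof.
apply: continuous_compact_integrable; first exact: segment_compact.
exact: within_gamma_kernel.
Qed.

Let integral_gamma_kernel_S a n :
  (a%:E * \int[mu]_(t in S n) (gamma_kernel (a - 1) t)%:E =
   (gamma_kernel a n.+2%:R - gamma_kernel a n.+1%:R^-1)%:E +
  \int[mu]_(t in S n) (gamma_kernel a t)%:E)%E.
Proof.
have ha := integrable_gamma_kernel_S a n.
have ha1 := integrable_gamma_kernel_S (a - 1) n.
have -> : ((gamma_kernel a n.+2%:R - gamma_kernel a n.+1%:R^-1)%:E =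
  \int[mu]_(t in S n) (a * gamma_kernel (a - 1) t - gamma_kernel a t)%:E)%E.
  rewrite EFinB; symmetry.
  apply: continuous_FTC2; first exact: S_lt.
  - apply: continuous_in_subspaceT => t /set_mem /S_gt0 t0.
    apply: cvgB; last exact: continuous_gamma_kernel.
    by apply: cvgMr; exact: continuous_gamma_kernel.
  - split.
    + move=> t ht; have t0 : 0 < t by apply: (@S_gt0 n); exact: subset_itv_oo_cc ht.
      by have [] := is_derive_gamma_kernel a t0.
    + apply: cvg_at_right_filter; apply: continuous_gamma_kernel; by rewrite invr_gt0.
    + by apply: cvg_at_left_filter; apply: continuous_gamma_kernel.
  - move=> t ht; have t0 : 0 < t by apply: (@S_gt0 n); exact: subset_itv_oo_cc ht.
    by rewrite derive1E; have [_ ->] := is_derive_gamma_kernel a t0.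
transitivity (\int[mu]_(t in S n) (((a * gamma_kernel (a - 1) t -
    gamma_kernel a t)%:E + (gamma_kernel a t)%:E))%E)%E.
  transitivity (\int[mu]_(t in S n) (a%:E * (gamma_kernel (a - 1) t)%:E))%E.
    by rewrite integralZl//; by rewrite /S.
  by apply: eq_integral => t _ /=; rewrite -EFinM -EFinD subrK.
rewrite integralD//; first by rewrite /S.
under eq_fun do rewrite EFinB EFinM.
by apply: integrableB; [by rewrite /S|apply: integrableZl => //;by rewrite /S|].
Qed.

(** Partial integration on the half-line.  The identity is in [\bar R], with no
    integrability hypothesis: it transports finiteness as well as values, which
    is how [integrable_gamma_kernel] uses it. *)
Lemma integral_gamma_kernelS a : 0 < a ->
  (\int[mu]_(t in D) (gamma_kernel a t)%:E =
   a%:E * \int[mu]_(t in D) (gamma_kernel (a - 1) t)%:E)%E.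
Proof.
move=> a0.
have cvgJ b : (\int[mu]_(t in S n) (gamma_kernel b t)%:E @[n --> \oo] -->
    \int[mu]_(t in D) (gamma_kernel b t)%:E)%E.
  rewrite -bigcup_S; apply: ge0_nondecreasing_set_cvg_integral.
  - exact: nondecreasing_S.
  - by move=> n; rewrite /S.
  - by move=> n; apply/measurable_EFinP; exact: measurable_gamma_kernel.
  - by move=> n t _; rewrite lee_fin gamma_kernel_ge0.
have := cvgeZl (isT : a%:E \is a fin_num) (cvgJ (a - 1)).
under eq_cvg do rewrite integral_gamma_kernel_S.
have bnd : ((gamma_kernel a n.+2%:R - gamma_kernel a n.+1%:R^-1)%:E @[n --> \oo]
    --> 0%:E)%E.
  apply: cvg_EFin; first exact: nearW.
  rewrite -[X in _ --> X](subrr 0); apply: cvgB.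
    apply: (cvg_pinftyP _ _).1 (gamma_kernel_cvgy a0) _ _.
    apply/cvgryPge => r; near=> n; rewrite (@le_trans _ _ n%:R)//.
      by near: n; exact: nbhs_infty_ger.
    by rewrite ler_nat !leqW.
  apply: (cvg_at_rightP _ _ _).1 (gamma_kernel_cvg0 a0) (fun n => n.+1%:R^-1) _.
  by split => [n|]; [rewrite invr_gt0|exact: cvg_harmonic].
have := cvgeD _ bnd (cvgJ a).
rewrite add0e => /(_ _ isT) h1 h2.
exact: (cvg_unique _ h1 h2).
Unshelve. all: end_near. Qed.

Lemma euler_integralE a : euler_integral a = \int[mu]_(t in D) gamma_kernel (a - 1) t.
Proof. by []. Qed.

Let integrable_gamma_kernelE b : mu.-integrable D (EFin \o gamma_kernel b) <->
  (\int[mu]_(t in D) (gamma_kernel b t)%:E < +oo)%E.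
Proof.
have e : (\int[mu]_(t in D) `|(EFin \o gamma_kernel b) t| =
          \int[mu]_(t in D) (gamma_kernel b t)%:E)%E.
  by apply: eq_integral => t _ /=; rewrite ger0_norm// gamma_kernel_ge0.
split; first by move/integrableP => [_]; rewrite e.
move=> h; apply/integrableP; rewrite e; split => //.
by apply/measurable_EFinP; exact: measurable_gamma_kernel.
Qed.

Let integrable_expN : mu.-integrable D (EFin \o gamma_kernel 0).
Proof.
have h : mu.-integrable D (EFin \o @exponential_pdf R 1).
  by apply: integrableS (integrable_exponential_pdf ltr01).
apply: eq_integrable h => //= t; rewrite inE/= in_itv/= andbT => t0.
rewrite exponential_pdfE ?(ltW t0)// /gamma_kernel powRr0.
by rewrite mulN1r mul1r mulr1.
Qed.

(** The exponent 0 bounds the kernel on [t <= 1] and the largest exponent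
    bounds it on [t > 1]. *)
Lemma gamma_kernel_le_add v c t : 0 < t -> 0 <= c -> c <= v ->
  gamma_kernel c t <= gamma_kernel 0 t + gamma_kernel v t.
Proof.
move=> t0 c0 cv; rewrite /gamma_kernel -mulrDr ler_wpM2l ?expR_ge0// powRr0.
have [t1|t1] := leP t 1.
  by rewrite ler_wpDr ?powR_ge0// -[leRHS](powRr0 t) ger_powR ?t0 ?t1.
by rewrite ler_wpDl// ler_powR// ltW.
Qed.

(** The functional equation climbs from [expR (- t)] to all natural exponents,
    domination fills in the real exponents [b >= 0], and the functional equation
    read downwards reaches [-1 < b]. *)
Lemma integrable_gamma_kernel b : -1 < b ->
  mu.-integrable D (EFin \o gamma_kernel b).
Proof.
have nat_case n : mu.-integrable D (EFin \o gamma_kernel n%:R).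
  elim: n => [|n IH]; first exact: integrable_expN.
  apply/integrable_gamma_kernelE; rewrite integral_gamma_kernelS//.
  rewrite -natr1 addrK lte_mul_pinfty//.
  exact/integrable_gamma_kernelE.
have ge0_case c : 0 <= c -> mu.-integrable D (EFin \o gamma_kernel c).
  move=> c0; have [n _ hn] := nbhs_infty_ger c.
  have : mu.-integrable D (fun t => (EFin \o gamma_kernel 0) t + (EFin \o gamma_kernel n%:R) t)%E.
    exact: integrableD.
  apply: le_integrable => //.
    by apply/measurable_EFinP; exact: measurable_gamma_kernel.
  move=> t; rewrite /= in_itv/= andbT => t0.
  rewrite lee_fin !ger0_norm ?addr_ge0 ?gamma_kernel_ge0//.
  exact: gamma_kernel_le_add (hn n (leqnn n)).
move=> b1; apply/integrable_gamma_kernelE.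
have b10 : 0 < b + 1 by lra.
have := (integrable_gamma_kernelE (b + 1)).1 (ge0_case _ (ltW b10)).
rewrite integral_gamma_kernelS// addrK.
apply: contraTT; rewrite -!leNgt !leye_eq => /eqP ->.
by rewrite gt0_muley// lte_fin.
Qed.

Lemma euler_integralS a : 0 < a -> euler_integral (a + 1) = a * euler_integral a.
Proof.
move=> a0; rewrite !euler_integralE /Rintegral addrK integral_gamma_kernelS//.
rewrite fineM// integral_fune_fin_num//; apply: integrable_gamma_kernel; lra.
Qed.

End EulerIntegral.

(** * Growth and derivative of the Euler integral *)

Section EulerIntegralDerivative.
Context {R : realType}.
Implicit Types a b s t : R.
Local Notation mu := lebesgue_measure.
Local Notation D := (`]0, +oo[%classic : set R).

(** The integral over [[M, M + 1]] alone, with [M = expR s], already grows like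
    [M `^ a].  As [M] is arbitrary, [1 / Gamma] decays faster than every
    exponential. *)
Lemma euler_integral_ge s a : 0 <= s -> 1 <= a ->
  expR (s * (a - 1)) * expR (- (expR s + 1)) <= euler_integral a.
Proof.
move=> s0 a1; set M := expR s.
have M1 : 1 <= M by rewrite -expR0 ler_expR.
set c := (X in X <= _).
have c0 : 0 <= c by rewrite mulr_ge0 ?expR_ge0.
have int : mu.-integrable D (EFin \o gamma_kernel (a - 1)).
  by apply: integrable_gamma_kernel; lra.
rewrite -lee_fin /euler_integral /Rintegral fineK; last first.
  exact: integrable_fin_num.
have -> : (c%:E = \int[mu]_(t in `[M, (M + 1)%R]%classic) c%:E)%E.
  rewrite integral_cst//= lebesgue_measure_itv/= lte_fin ltrDl ltr01.
  by rewrite -EFinD addrAC subrr add0r mule1.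
apply: (@le_trans _ _ (\int[mu]_(t in `[M, (M + 1)%R]%classic) (gamma_kernel (a - 1) t)%:E)%E).
  apply: ge0_le_integral => //.
  - by apply/measurable_EFinP; exact: measurable_gamma_kernel.
  - move=> t; rewrite /= in_itv/= => /andP[Mt tM]; rewrite lee_fin /c /gamma_kernel mulrC.
    have -> : expR (s * (a - 1)) = M `^ (a - 1).
      by rewrite /powR gt_eqF ?expR_gt0// expRK mulrC.
    apply: ler_pM; rewrite ?expR_ge0 ?powR_ge0//.
      by rewrite ler_expR lerN2.
    apply: ge0_ler_powR => //; rewrite ?nnegrE; lra.
apply: ge0_subset_integral => //=.
- by apply/measurable_EFinP; exact: measurable_gamma_kernel.
- by move=> t _; rewrite lee_fin; exact: gamma_kernel_ge0.
- move=> t; rewrite /= !in_itv/= andbT => /andP[Mt _].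
  by rewrite (lt_le_trans _ Mt)// expR_gt0.
Qed.

(** The lower bound needs [1 <= a]; the functional equation covers the rest. *)
Lemma euler_integral_gt0 a : 0 < a -> 0 < euler_integral a.
Proof.
move=> a0; have a1 : 1 <= a + 1 by rewrite lerDr ltW.
have := euler_integral_ge (lexx 0) a1; rewrite euler_integralS// => h.
by rewrite -(pmulr_rgt0 _ a0) (lt_le_trans _ h)// mulr_gt0 ?expR_gt0.
Qed.

Lemma normr_ln_le t : 0 < t -> `|ln t| <= t + t^-1.
Proof.
move=> t0; have ti0 : 0 < t^-1 by rewrite invr_gt0.
have := ln_sublinear t0; have := ln_sublinear ti0; rewrite lnV ?posrE// => h1 h2.
rewrite ler_norml; apply/andP; split; lra.
Qed.

Definition log_gamma_kernel a t : R := gamma_kernel (a - 1) t * ln t.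

Definition euler_integral_log a : R := \int[mu]_(t in D) log_gamma_kernel a t.

Lemma is_derive_gamma_kernel_exponent a t : 0 < t ->
  is_derive a 1 (fun b => gamma_kernel (b - 1) t) (log_gamma_kernel a t).
Proof.
move=> t0.
have -> : (fun b => gamma_kernel (b - 1) t) = (fun b => expR (- t) * expR ((b - 1) * ln t)).
  by apply/funext => b; rewrite /gamma_kernel /powR gt_eqF.
rewrite /log_gamma_kernel /gamma_kernel /powR gt_eqF//.
apply: is_derive_eq; rewrite /GRing.scale /=. by ring.
Qed.

(** The logarithm is absorbed by moving the exponent up and down by one, so that
    the derivative of the Euler integral is controlled by Euler integrals. *)
Lemma normr_log_gamma_kernel_le a t : 0 < t ->
  `|log_gamma_kernel a t| <= gamma_kernel a t + gamma_kernel (a - 1 - 1) t.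
Proof.
move=> t0; rewrite normrM ger0_norm ?gamma_kernel_ge0//.
apply: le_trans (ler_wpM2l (gamma_kernel_ge0 _ _) (normr_ln_le t0)) _.
rewrite le_eqVlt; apply/orP; left; apply/eqP.
rewrite /gamma_kernel mulrDr -!mulrA; congr (_ * _ + _ * _).
  by rewrite -[in RHS](subrK 1 a) [in RHS]powRD ?(gt_eqF t0) ?implybT// powRr1// ltW.
by rewrite [in RHS]powRB ?(gt_eqF t0) ?implybT// powRr1// ltW.
Qed.

Lemma measurable_log_gamma_kernel a (A : set R) : measurable_fun A (log_gamma_kernel a).
Proof.
apply: measurable_funM; first exact: measurable_gamma_kernel.
by apply: measurable_funTS; exact: measurable_ln.
Qed.

Lemma integrable_log_gamma_kernel a : 1 < a -> mu.-integrable D (EFin \o log_gamma_kernel a).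
Proof.
move=> a1.
have : mu.-integrable D (fun t => (EFin \o gamma_kernel a) t + (EFin \o gamma_kernel (a - 1 - 1)) t)%E.
  by apply: integrableD => //; apply: integrable_gamma_kernel; lra.
apply: le_integrable => //.
  by apply/measurable_EFinP; exact: measurable_log_gamma_kernel.
move=> t; rewrite /= in_itv/= andbT => t0.
rewrite lee_fin (le_trans (normr_log_gamma_kernel_le _ t0))//.
exact: ler_norm.
Qed.

(** In terms of the digamma function: [`|digamma a| <= a + 1] for [2 <= a]. *)
Lemma normr_euler_integral_log_le a : 2 <= a ->
  `|euler_integral_log a| <= (a + 1) * euler_integral a.
Proof.
move=> a2; have i1 : mu.-integrable D (EFin \o gamma_kernel (a + 1 - 1)).
  by apply: integrable_gamma_kernel; lra.
have i2 : mu.-integrable D (EFin \o gamma_kernel (a - 1 - 1)).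
  by apply: integrable_gamma_kernel; lra.
have i3 : mu.-integrable D (EFin \o log_gamma_kernel a).
  by apply: integrable_log_gamma_kernel; lra.
apply: (@le_trans _ _ (euler_integral (a + 1) + euler_integral (a - 1))).
  rewrite !euler_integralE -RintegralD//.
  apply: le_trans (le_normr_Rintegral _ i3) _ => //.
  apply: le_Rintegral => //.
  - exact: integrable_norm.
  - by apply: (integrableD _ i1 i2).
  - move=> t; rewrite /= in_itv/= andbT => t0.
    by rewrite addrK; exact: normr_log_gamma_kernel_le.
have e : euler_integral a = (a - 1) * euler_integral (a - 1).
  by rewrite -euler_integralS ?subrK//; lra.
have e0 : 0 < euler_integral (a - 1) by apply: euler_integral_gt0; lra.
rewrite euler_integralS; last lra.
rewrite mulrDl mul1r lerD2l e ler_peMl ?(ltW e0)//; lra.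
Qed.

(** An integrable bound of [log_gamma_kernel a] uniform in [a] between 2 and
    [v]: both exponents of [normr_log_gamma_kernel_le] lie between 0 and [v]. *)
Let dominating v t := gamma_kernel 0 t *+ 2 + gamma_kernel v t *+ 2.

Let dominating_ge0 v t : 0 <= dominating v t.
Proof. by rewrite addr_ge0// mulrn_wge0// gamma_kernel_ge0. Qed.

Let integrable_dominating v : 0 <= v -> mu.-integrable D (EFin \o dominating v).
Proof.
move=> v0; have [i0 i1] : mu.-integrable D (EFin \o gamma_kernel 0) /\
  mu.-integrable D (EFin \o gamma_kernel v).
  by split; apply: integrable_gamma_kernel; lra.
have addi f g : mu.-integrable D (EFin \o f) -> mu.-integrable D (EFin \o g) ->
    mu.-integrable D (EFin \o (f \+ g)).
  by move=> fi gi; apply: (integrableD _ fi gi).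
exact: addi (addi _ _ i0 i0) (addi _ _ i1 i1).
Qed.

Let log_gamma_kernel_dominated v a t : 0 < t -> a \in `]2, v[ ->
  `|log_gamma_kernel a t| <= dominating v t.
Proof.
move=> t0; rewrite in_itv/= => /andP[a2 av].
apply: le_trans (normr_log_gamma_kernel_le _ t0) _.
have h c : 0 <= c <= v -> gamma_kernel c t <= gamma_kernel 0 t + gamma_kernel v t.
  by case/andP; exact: gamma_kernel_le_add.
have h1 : 0 <= a <= v by lra.
have h2 : 0 <= a - 1 - 1 <= v by lra.
have := lerD (h _ h1) (h _ h2); rewrite /dominating !mulr2n; lra.
Qed.

(** Only [2 < a] is treated: there the shifted exponent [a - 2] is positive and
    the integrand needs no care at 0, and the recursion [rGammaS] carries the
    conclusion for [1 / Gamma] from this range to the whole line. *)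
Lemma is_derive_euler_integral a : 2 < a ->
  is_derive a 1 (@euler_integral R) (euler_integral_log a).
Proof.
move=> a2; pose f b t := gamma_kernel (b - 1) t.
have Ia : (`]2, a + 1[%classic : set R) a by rewrite /= in_itv/= a2 ltrDl ltr01.
have d1 b t : D t -> partial1of2 f b t = log_gamma_kernel b t.
  rewrite /= in_itv/= andbT => t0; rewrite partial1of2E.
  by have [_ ->] := is_derive_gamma_kernel_exponent b t0.
have intf b : (`]2, a + 1[%classic : set R) b -> mu.-integrable D (EFin \o f b).
  by rewrite /= in_itv/= => /andP[b2 _]; apply: integrable_gamma_kernel; lra.
have derf b t : (`]2, a + 1[%classic : set R) b -> D t -> derivable (f ^~ t) b 1.
  move=> _; rewrite /= in_itv/= andbT => t0.
  by have [] := is_derive_gamma_kernel_exponent b t0.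
have G_ub b t : (`]2, a + 1[%classic : set R) b -> D t ->
    `|partial1of2 f b t| <= dominating (a + 1) t.
  move=> Ib Dt; rewrite d1//; move: Dt; rewrite /= in_itv/= andbT => t0.
  exact: log_gamma_kernel_dominated.
have a10 : 0 <= a + 1 by lra.
apply: DeriveDef.
  by apply: (derivable_under_integral _ Ia intf derf (dominating_ge0 _)
    (integrable_dominating a10) G_ub).
rewrite -derive1E.
rewrite (differentiation_under_integral _ Ia intf derf (dominating_ge0 _)
    (integrable_dominating a10) G_ub)//.
by apply: eq_Rintegral => t /set_mem Dt; rewrite d1.
Qed.

Lemma continuous_euler_integral_log a : 2 < a ->
  {for a, continuous euler_integral_log}.
Proof.
move=> a2.
have h := @continuity_under_integral R _ _ mu log_gamma_kernel D _ 2 (a + 1)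
  _ _ (dominating (a + 1)).
apply: h => //.
- move=> b; rewrite /= in_itv/= => /andP[b2 _]; apply: integrable_log_gamma_kernel; lra.
- apply: aeW => t; rewrite /= in_itv/= andbT => t0 b _.
  have [/derivable1_diffP/differentiable_continuous c _] :=
    is_derive_gamma_kernel_exponent b t0.
  by apply: cvgMl; exact: c.
- apply: integrable_dominating; lra.
- move=> b Ib; apply: aeW => t; rewrite /= in_itv/= andbT => t0.
  exact: log_gamma_kernel_dominated.
- by rewrite inE/= in_itv/= a2 ltrDl ltr01.
Qed.

End EulerIntegralDerivative.

(** * The reciprocal Gamma function *)

(** The rate is arbitrary because the decay has to beat [x ^+ k] for every [x]. *)
Definition superexponential_decay {R : realType} (f : R -> R) : Prop :=
  forall s b, 0 <= s ->
  exists2 C, 0 <= C & forall z, b <= z -> `|f z| <= C * expR (- (s * z)).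

Section ReciprocalGamma.
Context {R : realType}.
Implicit Types a s z : R.

Lemma pochhammer0 a : pochhammer a 0 = 1.
Proof. by rewrite /pochhammer big_geq. Qed.

Lemma pochhammerS a k : pochhammer a k.+1 = a * pochhammer (a + 1) k.
Proof.
rewrite /pochhammer big_nat_recl// addr0; congr (_ * _).
by apply: eq_bigr => i _; rewrite -natr1 addrCA addrC addrAC -addrA.
Qed.

(** The entire function [1 / Gamma].  At the poles of [Gamma] the conventions
    [x / 0 = 0] and [0^-1 = 0] give the value 0 of its continuous extension. *)
Definition rGamma z : R := (Gamma z)^-1.

(** For [z <= 0] the number of shifts in the continued integral is determined by
    the unit interval that contains [z]. *)
Let Gamma_npos z m : z <= 0 -> - m%:R <= z < 1 - m%:R ->
  Gamma z = euler_integral (z + m.+1%:R) / pochhammer z m.+1.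
Proof.
move=> z0 hz; have fz : Num.floor z = - m%:Z.
  by apply: floor_def; rewrite intrD mulrNz mulr1z -pmulrn addrC.
by rewrite /Gamma ltNge z0 /= fz abszN absz_nat.
Qed.

(** Free of division, hence valid at the poles too; every property of [rGamma]
    below is proved far to the right and carried leftwards one unit at a time by
    this equation. *)
Lemma rGammaS z : rGamma z = z * rGamma (z + 1).
Proof.
rewrite /rGamma; have [z0|z0] := ltP 0 z.
  rewrite /Gamma z0 addr_gt0// euler_integralS// invfM mulrA divff ?mul1r//.
  by rewrite gt_eqF.
have [m hm] : exists m, - m%:R <= z < 1 - m%:R.
  exists `|Num.floor z|%N.
  have f0 : Num.floor z <= 0 by rewrite floor_le0 (le_lt_trans z0).
  have -> : `|Num.floor z|%N%:R = - (Num.floor z)%:~R :> R.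
    by rewrite pmulrn -mulrNz; congr (_%:~R); rewrite -ler0_norm.
  rewrite !opprK floor_le addrC; have := floorD1_gt z; by rewrite intrD.
rewrite (Gamma_npos z0 hm); case: m hm => [|k] hm.
  have -> : z = 0 by move: hm; rewrite oppr0; lra.
  by rewrite pochhammerS !mul0r invr0 mulr0 invr0.
rewrite pochhammerS; have [z10|z10] := ltP 0 (z + 1).
  (* [z <= 0 < z + 1] leaves only the unit interval [-1 <= z < 0]. *)
  have -> : k = 0%N.
    apply/eqP; rewrite -leqn0 -ltnS -(ltr_nat R); move: hm; rewrite -natr1; lra.
  rewrite pochhammerS pochhammer0 mulr1 /Gamma z10 -addn1 natrD addrA.
  rewrite (euler_integralS z10) invfM invrK; field.
  by rewrite !gt_eqF ?euler_integral_gt0//.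
rewrite (@Gamma_npos _ k)//; last by move: hm; rewrite -natr1; lra.
rewrite -addrA nat1r !invfM !invrK; ring.
Qed.

Lemma rGammaE z : 0 < z -> rGamma z = (euler_integral z)^-1.
Proof. by move=> z0; rewrite /rGamma /Gamma z0. Qed.

Lemma rGamma_pochhammer a k : rGamma a = pochhammer a k * rGamma (a + k%:R).
Proof.
elim: k a => [|k IH] a; first by rewrite pochhammer0 mul1r addr0.
by rewrite pochhammerS rGammaS IH mulrA -natr1 addrA addrAC.
Qed.

Local Notation drGamma := (derive1 rGamma).

Let is_derive_rGamma_gt2 z : 2 < z ->
  is_derive z 1 rGamma (- (euler_integral z) ^- 2 * euler_integral_log z).
Proof.
move=> z2; have z0 : 0 < z by lra.
have e0 : euler_integral z != 0 by rewrite gt_eqF// euler_integral_gt0.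
have dE := is_derive_euler_integral z2.
apply: (@near_eq_is_derive _ _ _ (fun z => (euler_integral z)^-1)).
by near=> y; rewrite rGammaE//; near: y; exact: lt_nbhsr.
Unshelve. all: end_near. Qed.

Let is_derive_rGamma_rec z : derivable rGamma (z + 1) 1 ->
  is_derive z 1 rGamma (rGamma (z + 1) + z * drGamma (z + 1)).
Proof.
move=> d.
have d1 : is_derive z 1 (fun z => rGamma (z + 1)) (drGamma (z + 1)).
  have h : is_derive (z + 1) 1 rGamma (drGamma (z + 1)).
    by apply: DeriveDef => //; rewrite derive1E.
  have := @is_derive1_comp _ rGamma (shift 1) z _ 1 h (is_derive_shift z 1 1).
  by rewrite mulr1.
have e : rGamma = (fun z => z * rGamma (z + 1)).
  by apply/funext => y; rewrite {1}rGammaS.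
rewrite {1}e; have h := is_deriveM (is_derive_id z 1) d1.
apply: is_derive_eq; rewrite /GRing.scale /=; ring.
Qed.

(** Differentiability across the poles of [Gamma], where neither [Gamma] nor the
    Euler integral is differentiable, comes from the recursion. *)
Lemma derivable_rGamma z : derivable rGamma z 1.
Proof.
have h n : forall y, 2 - n%:R < y -> derivable rGamma y 1.
  elim: n => [|n IH] y hy.
    have y2 : 2 < y by lra.
    by have [] := is_derive_rGamma_gt2 y2.
  have y1 : 2 - n%:R < y + 1 by move: hy; rewrite -natr1; lra.
  by have [] := is_derive_rGamma_rec (IH _ y1).
have [n _ hn] := nbhs_infty_ger (3 - z).
apply: (h n); have := hn n (leqnn n); rewrite /=; lra.
Qed.

Lemma drGammaS z : drGamma z = rGamma (z + 1) + z * drGamma (z + 1).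
Proof.
have [_ <-] := is_derive_rGamma_rec (@derivable_rGamma (z + 1)).
by rewrite derive1E.
Qed.

Let drGamma_gt2 z : 2 < z ->
  drGamma z = - (euler_integral z) ^- 2 * euler_integral_log z.
Proof. by move=> /is_derive_rGamma_gt2[_ <-]; rewrite derive1E. Qed.

Lemma continuous_rGamma : continuous rGamma.
Proof.
move=> z; apply: differentiable_continuous; apply/derivable1_diffP.
exact: derivable_rGamma.
Qed.

Lemma continuous_drGamma : continuous drGamma.
Proof.
have h n : forall y, 2 - n%:R < y -> {for y, continuous drGamma}.
  elim: n => [|n IH] y hy.
    have y2 : 2 < y by lra.
    have y0 : 0 < y by lra.
    have e0 : euler_integral y != 0 by rewrite gt_eqF// euler_integral_gt0.
    rewrite /prop_for /continuous_at (drGamma_gt2 y2).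
    have cE : {for y, continuous (@euler_integral R)}.
      apply: differentiable_continuous; apply/derivable1_diffP.
      by have [] := is_derive_euler_integral y2.
    have cEV : euler_integral x ^- 2 @[x --> y] --> euler_integral y ^- 2.
      apply: cvgV; first by rewrite expf_neq0.
      by under eq_cvg do rewrite expr2; rewrite expr2; exact: (cvgM cE cE).
    have c : - euler_integral x ^- 2 * euler_integral_log x @[x --> y] -->
             - euler_integral y ^- 2 * euler_integral_log y.
      by apply: cvgM; [exact: cvgN|exact: continuous_euler_integral_log].
    apply: cvg_trans c; apply: near_eq_cvg; near=> x.
    by rewrite drGamma_gt2//; near: x; exact: lt_nbhsr.
  rewrite (_ : drGamma = fun y => rGamma (y + 1) + y * drGamma (y + 1)); last first.
    by apply/funext => x; rewrite drGammaS.
  have sh : {for y, continuous (fun x : R => x + 1)}.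
    by apply: cvgD; [exact: cvg_id|exact: cvg_cst].
  apply: cvgD; first by apply: (continuous_comp sh); exact: continuous_rGamma.
  apply: cvgM; first exact: cvg_id.
  apply: (continuous_comp sh); apply: IH; move: hy; rewrite -natr1; lra.
move=> z; have [n _ hn] := nbhs_infty_ger (3 - z).
apply: (h n); have := hn n (leqnn n); rewrite /=; lra.
Unshelve. all: end_near. Qed.

(** The lower bound of the Euler integral is used at the rate [s + 1]: the extra
    unit pays for the factor [z + 1 <= expR z] that bounds the digamma function. *)
Let decay_ge3 s : 0 <= s -> exists2 C, 0 <= C &
  forall z, 3 <= z -> `|rGamma z| <= C * expR (- (s * z)) /\
                      `|drGamma z| <= C * expR (- (s * z)).
Proof.
move=> s0; pose r := s + 1; have r0 : 0 <= r by rewrite addr_ge0.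
exists (expR (r + (expR r + 1))); first exact: expR_ge0.
move=> z z3.
have z0 : 0 < z by lra.
have z1 : 1 <= z by lra.
have z2 : 2 < z by lra.
have E0 := euler_integral_gt0 z0.
have EV : (z + 1) / euler_integral z <= expR (r + (expR r + 1)) * expR (- (s * z)).
  rewrite ler_pdivrMr//.
  apply: (@le_trans _ _ (expR (r + (expR r + 1)) * expR (- (s * z)) *
     (expR (r * (z - 1)) * expR (- (expR r + 1))))); last first.
    by rewrite ler_wpM2l ?mulr_ge0 ?expR_ge0// euler_integral_ge.
  rewrite -!expRD addrC (_ : _ + _ = z) ?expR_ge1Dx// /r; ring.
have rE : rGamma z <= (z + 1) / euler_integral z.
  by rewrite rGammaE// ler_peMl ?invr_ge0 ?ltW//; lra.
split.
  by rewrite ger0_norm ?(le_trans rE)// rGammaE// invr_ge0 ltW.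
apply: le_trans EV; rewrite drGamma_gt2// normrM normrN normfV normrX gtr0_norm//.
rewrite mulrC ler_pdivrMr ?exprn_gt0// expr2 mulrA divfK ?gt_eqF//.
by apply: normr_euler_integral_log_le; lra.
Qed.

(** One step to the left multiplies by [z], which is at most an exponential; so
    the step at the rate [s] uses the induction hypothesis at [s + 1]. *)
Let decay_ge n s : 0 <= s -> exists2 C, 0 <= C &
  forall z, 3 - n%:R <= z -> `|rGamma z| <= C * expR (- (s * z)) /\
                      `|drGamma z| <= C * expR (- (s * z)).
Proof.
elim: n s => [|n IH] s s0.
  by have [C C0 h] := decay_ge3 s0; exists C => // z; rewrite subr0; exact: h.
have [C1 C10 h1] := IH s s0.
have s10 : 0 <= s + 1 by rewrite addr_ge0.
have [C2 C20 h2] := IH _ s10.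
exists (C1 + C2 * expR (n%:R *+ 2)); first by rewrite addr_ge0 ?mulr_ge0 ?expR_ge0.
move=> z hz; have hz1 : 3 - n%:R <= z + 1 by move: hz; rewrite -natr1; lra.
have [rG1 dG1] := h1 _ hz1; have [rG2 dG2] := h2 _ hz1.
have n0 : 0 <= n%:R :> R by [].
have zle : `|z| <= expR (z + n%:R *+ 2).
  apply: le_trans (expR_ge1Dx _); move: hz; rewrite -natr1 mulr2n => hz.
  by rewrite ler_norml; apply/andP; split; lra.
have prod x : `|x| <= C2 * expR (- ((s + 1) * (z + 1))) ->
    `|z| * `|x| <= C2 * expR (n%:R *+ 2) * expR (- (s * z)).
  move=> hx; apply: le_trans (ler_pM _ _ zle hx) _ => //.
  rewrite mulrCA -mulrA ler_wpM2l// -!expRD ler_expR; nra.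
have shift x : `|x| <= C1 * expR (- (s * (z + 1))) -> `|x| <= C1 * expR (- (s * z)).
  move=> /le_trans; apply; rewrite ler_wpM2l// ler_expR; nra.
rewrite rGammaS drGammaS normrM mulrDl; split.
  by rewrite ler_wpDl ?mulr_ge0 ?expR_ge0// prod.
apply: le_trans (ler_normD _ _) _; rewrite normrM lerD ?shift ?prod//.
Qed.

Lemma rGamma_decay : superexponential_decay rGamma.
Proof.
move=> s b s0; have [n _ /(_ n (leqnn n)) /= hn] := nbhs_infty_ger (3 - b).
have [C C0 h] := decay_ge n s0; exists C => // z bz.
by apply: (h z _).1; lra.
Qed.

Lemma drGamma_decay : superexponential_decay drGamma.
Proof.
move=> s b s0; have [n _ /(_ n (leqnn n)) /= hn] := nbhs_infty_ger (3 - b).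
have [C C0 h] := decay_ge n s0; exists C => // z bz.
by apply: (h z _).2; lra.
Qed.

Lemma rGamma_neq0 z : ~~ Gamma_pole z -> rGamma z != 0.
Proof.
have h n : forall z, - n%:R < z -> ~~ Gamma_pole z -> rGamma z != 0.
  elim: n => [|n IH] y yn yP.
    have y0 : 0 < y by move: yn; rewrite oppr0.
    by rewrite rGammaE// invr_neq0// gt_eqF// euler_integral_gt0.
  rewrite rGammaS mulf_neq0//.
    by apply: contraNneq yP => ->; rewrite /Gamma_pole lexx rpred0.
  apply: IH; first by move: yn; rewrite -natr1; lra.
  apply: contraNN yP => /andP[y1 y10]; apply/andP; split; last lra.
  by rewrite -(addrK 1 y) rpredB// rpred1.
have [n _ /(_ n (leqnn n)) /= hn] := nbhs_infty_ger (1 - z).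
apply: (h n); lra.
Qed.

(** Turns the digamma coefficients of [Q] into values of a function that is
    continuous on the whole line. *)
Lemma digamma_div_Gamma z : ~~ Gamma_pole z -> digamma z / Gamma z = - drGamma z.
Proof.
move=> /rGamma_neq0 r0.
have e : @Gamma R = (fun y => (rGamma y)^-1).
  by apply/funext => y; rewrite /rGamma invrK.
have dr : is_derive z 1 rGamma (drGamma z).
  by apply: DeriveDef; [exact: derivable_rGamma|rewrite derive1E].
have [_ d] := is_deriveV r0 dr.
rewrite /digamma derive1E e d /GRing.scale /= !invrK; field.
by [].
Qed.

End ReciprocalGamma.

(** * Sums dominated by a geometric series *)

Section GeometricDomination.
Context {R : realType}.
Implicit Types (a : nat -> R) (C : R).

Lemma cvg_sum_geometric_dominated a C :
  (forall k, (0 < k)%N -> `|a k| <= C * 2^-1 ^+ k) ->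
  cvgn (fun n => \sum_(1 <= k < n) a k).
Proof.
move=> ha; have h : cvgn (series (fun k => a k.+1)).
  apply: normed_cvg; apply: (@series_le_cvg _ _ (geometric (C * 2^-1) 2^-1)).
  - by move=> n; exact: normr_ge0.
  - by move=> n; rewrite /= -mulrA -exprS (le_trans _ (ha n.+1 isT)).
  - by move=> n; rewrite /= -mulrA -exprS; exact: ha.
  - by apply: is_cvg_geometric_series; rewrite ger0_norm// invf_lt1// ltr1n.
have [l hl] := (cvg_ex _).1 h; apply/cvg_ex; exists l; rewrite -cvg_shiftS /=.
by under eq_cvg do rewrite big_add1 /=.
Qed.

Lemma sum_geometric_tail a C N n :
  (forall k, (0 < k)%N -> `|a k| <= C * 2^-1 ^+ k) -> (0 < N)%N -> (N <= n)%N ->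
  `|\sum_(1 <= k < n) a k - \sum_(1 <= k < N) a k| <= C * 2^-1 ^+ N *+ 2.
Proof.
move=> ha N0 Nn; rewrite (@big_cat_nat _ _ _ N)//= addrAC subrr add0r.
have C0 : 0 <= C.
  by have := le_trans (normr_ge0 _) (ha 1%N isT); rewrite pmulr_lge0// exprn_gt0.
suff : `|\sum_(N <= k < n) a k| <= C * (2^-1 ^+ N - 2^-1 ^+ n) *+ 2.
  move=> /le_trans; apply; rewrite lerMn2r/= ler_wpM2l// gerBl exprn_ge0//.
elim: n Nn => [|n IH]; first by rewrite leqn0 => /eqP N00; rewrite N00 in N0.
rewrite leq_eqVlt => /predU1P[->|]; first by rewrite big_geq// normr0 subrr mulr0 mul0rn.
rewrite ltnS => Nn; rewrite big_nat_recr//=.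
apply: le_trans (ler_normD _ _) _.
have := lerD (IH Nn) (ha n (leq_trans N0 Nn)); move=> /le_trans; apply.
by rewrite exprS !mulr2n le_eqVlt; apply/orP; left; apply/eqP; field.
Qed.

Lemma lim_geometric_tail a C N :
  (forall k, (0 < k)%N -> `|a k| <= C * 2^-1 ^+ k) -> (0 < N)%N ->
  `|limn (fun n => \sum_(1 <= k < n) a k) - \sum_(1 <= k < N) a k| <=
  C * 2^-1 ^+ N *+ 2.
Proof.
move=> ha N0; have ca := cvg_sum_geometric_dominated ha.
have h : `|\sum_(1 <= k < n) a k - \sum_(1 <= k < N) a k| @[n --> \oo] -->
    `|limn (fun n => \sum_(1 <= k < n) a k) - \sum_(1 <= k < N) a k|.
  by apply: cvg_norm; apply: cvgB => //; exact: cvg_cst.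
apply: (cvgr_to_le h).
by near=> n; apply: sum_geometric_tail => //; near: n; exact: nbhs_infty_ge.
Unshelve. all: end_near. Qed.

(** Tannery's theorem for sums dominated by a geometric series: a tail is small
    uniformly in [t], and the remaining finite sum converges.  It serves both
    for the termwise derivative and for the limit at a pole. *)
Lemma cvg_lim_sum_dominated {T : Type} (F : set_system T) {FF : ProperFilter F}
    (u : nat -> T -> R) (l : nat -> R) C :
  (forall k, (0 < k)%N -> u k t @[t --> F] --> l k) ->
  (\forall t \near F, forall k, (0 < k)%N -> `|u k t| <= C * 2^-1 ^+ k) ->
  limn (fun n => \sum_(1 <= k < n) u k t) @[t --> F] -->
  limn (fun n => \sum_(1 <= k < n) l k).
Proof.
move=> ul uC.
have lC k : (0 < k)%N -> `|l k| <= C * 2^-1 ^+ k.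
  move=> k0; have h : `|u k t| @[t --> F] --> `|l k| by apply: cvg_norm; exact: ul.
  apply: (cvgr_to_le h).
  by near=> t; apply: (near uC t).
apply/cvgrPdist_le => e e0.
have geo : C * 2^-1 ^+ n *+ 2 @[n --> \oo] --> (0 : R).
  have h : `|2^-1 : R| < 1 by rewrite ger0_norm// invf_lt1// ltr1n.
  rewrite -[X in _ --> X](mul0rn _ 2).
  by apply: cvgMn; exact: (cvg_geometric C h).
have e3 : 0 < e / 3 by lra.
have [N N0 hN] : exists2 N, (0 < N)%N & C * 2^-1 ^+ N *+ 2 <= e / 3.
  have [M _ hM] := (cvgrPdist_le _ _).1 geo _ e3.
  exists M.+1 => //; have /= := hM M.+1 (leqnSn M); rewrite sub0r normrN.
  exact/le_trans/ler_norm.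
have cS : \sum_(1 <= k < N) u k t @[t --> F] --> \sum_(1 <= k < N) l k.
  rewrite big_nat; under eq_cvg do rewrite big_nat.
  by apply: (cvg_big add_continuous) => k /andP[k1 _]; exact: ul.
have cS3 := (cvgrPdist_le _ _).1 cS _ e3.
near=> t.
have := lim_geometric_tail lC N0.
have uCt : forall k, (0 < k)%N -> `|u k t| <= C * 2^-1 ^+ k by near: t; exact: uC.
have := @lim_geometric_tail (fun k => u k t) C N uCt N0.
have : `|\sum_(1 <= k < N) l k - \sum_(1 <= k < N) u k t| <= e / 3.
  by near: t; exact: cS3.
move: (limn _) (limn _) => A B h1 h2 h3.
move: h1 h2 h3; rewrite !ler_norml => /andP[? ?] /andP[? ?] /andP[? ?].
by apply/andP; split; lra.
Unshelve. all: end_near. Qed.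

End GeometricDomination.

(** * Termwise derivative and regrouping *)

Section TermwiseDerivative.
Context {R : realType}.
Implicit Types a b c x y z : R.
Local Notation drGamma := (derive1 (@rGamma R)).

(** When the arguments grow at least linearly in [k], superexponential decay at
    the rate [s] with [expR (s * d) = 1 + 2 * `|x|] beats [x ^+ k] by a factor
    [2 ^ k]. *)
Lemma decay_geometric_dominated (f : R -> R) x d b :
  superexponential_decay f -> 0 < d ->
  exists C, forall k z, d * k%:R + b <= z -> `|x ^+ k * f z| <= C * 2^-1 ^+ k.
Proof.
move=> fdecay d0; have x20 : 0 <= `|x| *+ 2 by rewrite mulrn_wge0.
have [s s0 sd] : exists2 s, 0 <= s & expR (s * d) = 1 + `|x| *+ 2.
  exists (ln (1 + `|x| *+ 2) / d).
    by rewrite divr_ge0 ?(ltW d0)// ln_ge0// lerDl.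
  by rewrite divfK ?gt_eqF// lnK// posrE ltr_wpDr.
have [C C0 hC] := fdecay s b s0.
exists (C * expR (- (s * b))) => k z hz.
have bz : b <= z by apply: le_trans hz; rewrite lerDr mulr_ge0// ltW.
rewrite normrM; apply: le_trans (ler_wpM2l (normr_ge0 _) (hC _ bz)) _.
rewrite mulrCA -mulrA ler_wpM2l// normrX.
have -> : expR (- (s * b)) * 2^-1 ^+ k = 2^-1 ^+ k * expR (- (s * b)) by rewrite mulrC.
apply: (@le_trans _ _ (`|x| ^+ k * (expR (- (s * d)) ^+ k * expR (- (s * b))))).
  rewrite ler_wpM2l ?exprn_ge0// -expRM_natl -expRD ler_expR.
  have := ler_wpM2l s0 hz; rewrite -mulr_natl; lra.
rewrite mulrA -exprMn ler_wpM2r ?expR_ge0// lerXn2r ?nnegrE ?mulr_ge0 ?expR_ge0//.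
rewrite expRN sd.
rewrite ler_pdivrMr ?ltr_wpDr// -(mulr_natr `|x| 2); lra.
Qed.

(** Reduces the domination of difference quotients to that of derivatives. *)
Lemma mean_value_quotient (f df : R -> R) a h : h != 0 ->
  (forall x, is_derive x 1 f (df x)) ->
  exists2 c, `|c - a| <= `|h| & h^-1 * (f (h + a) - f a) = df c.
Proof.
move=> h0 fdf.
have cf u v : {within `[u, v], continuous f}.
  by apply: derivable_within_continuous => z _; have [] := fdf z.
have [hgt|hlt] : 0 < h \/ h < 0 by apply/orP; rewrite -neq_lt eq_sym in h0 *.
- have [|c + E] := @MVT _ f df a (h + a) _ (fun z _ => fdf z) (cf _ _); first lra.
  rewrite in_itv/= => /andP[c1 c2]; exists c.
    by rewrite !ger0_norm; lra.
  by rewrite E addrK mulrCA mulVf// mulr1.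
- have [|c + E] := @MVT _ f df (h + a) a _ (fun z _ => fdf z) (cf _ _); first lra.
  rewrite in_itv/= => /andP[c1 c2]; exists c.
    by rewrite !ltr0_norm; lra.
  by rewrite -opprB E; field.
Qed.

(** The difference quotients of the terms are values of their derivatives at
    points [c] with [a / 2 <= c], where a single geometric series dominates. *)
Lemma is_derive_Ei a b x : 0 < a ->
  is_derive a 1 (fun alpha => Ei alpha b x)
    (limn (fun n => \sum_(1 <= k < n) x ^+ k * drGamma (a * k%:R + b))).
Proof.
move=> a0; pose t (k : nat) c := x ^+ k / k%:R * rGamma (c * k%:R + b).
have EiE c : Ei c b x = limn (fun n => \sum_(1 <= k < n) t k c).
  congr (lim (_ @ \oo)); apply/funext => n; apply: eq_bigr => k _.
  by rewrite /t /rGamma invfM mulrA.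
have dt k c : (0 < k)%N ->
    is_derive c 1 (t k) (x ^+ k * drGamma (c * k%:R + b)).
  move=> k0.
  have dg : is_derive c 1 (fun c => c * k%:R + b) k%:R.
    by apply: is_derive_eq; rewrite scaler0 add0r addr0 /GRing.scale/= mulr1.
  have dr : is_derive (c * k%:R + b) 1 rGamma (drGamma (c * k%:R + b)).
    by apply: DeriveDef; [exact: derivable_rGamma|rewrite derive1E].
  have h := @is_derive1_comp _ rGamma (fun c => c * k%:R + b) c _ _ dr dg.
  have := @is_deriveM _ _ _ _ _ _ _ _ (is_derive_cst (x ^+ k / k%:R) c 1) h.
  move=> {}h; apply: is_derive_eq; rewrite /GRing.scale /=.
  by field; rewrite pnatr_eq0 -lt0n.
have d0 : 0 < a / 2 by rewrite divr_gt0.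
have [C hC] := decay_geometric_dominated x b (@rGamma_decay R) d0.
have [D hD] := decay_geometric_dominated x b (@drGamma_decay R) d0.
have ct c : `|c - a| < a / 2 -> cvgn (fun n => \sum_(1 <= k < n) t k c).
  move=> ca; apply: (@cvg_sum_geometric_dominated _ _ C) => k k0.
  have cge : a / 2 <= c by move: ca; rewrite ltr_norml => /andP[]; lra.
  apply: le_trans (hC k (c * k%:R + b) _); last by rewrite lerD2r ler_wpM2r.
  rewrite /t mulrAC normrM ler_piMr// ger0_norm ?invr_ge0// invf_le1 ?ltr0n// ler1n//.
pose u (k : nat) h := h^-1 * (t k (h + a) - t k a).
have lim_u k : (0 < k)%N -> u k h @[h --> 0^'] --> x ^+ k * drGamma (a * k%:R + b).
  move=> k0; have [dv <-] := dt k a k0; rewrite /derive.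
  move: dv => /cvg_ex[l hl]; rewrite (cvg_lim _ hl)//.
  apply: cvg_trans hl; apply: near_eq_cvg; apply: nearW => h /=.
  by rewrite /u /GRing.scale /= mulr1.
have u_dom : \forall h \near 0^', forall k, (0 < k)%N -> `|u k h| <= D * 2^-1 ^+ k.
  near=> h => k k0.
  have h0 : h != 0 by near: h; exact: nbhs_dnbhs_neq.
  have ha : `|h| < a / 2 by near: h; exact: dnbhs0_lt.
  have [c ca E] := mean_value_quotient a h0 (fun c => dt k c k0); rewrite /u E.
  apply: hD; rewrite lerD2r ler_wpM2r//.
  by have := le_lt_trans ca ha; rewrite ltr_norml => /andP[]; lra.
have L0 : limn (fun n => \sum_(1 <= k < n) u k h) @[h --> 0^'] -->
    limn (fun n => \sum_(1 <= k < n) x ^+ k * drGamma (a * k%:R + b)).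
  exact: cvg_lim_sum_dominated lim_u u_dom.
have L : h^-1 *: (((fun alpha => Ei alpha b x) \o shift a) (h *: 1) - Ei a b x)
   @[h --> 0^'] --> limn (fun n => \sum_(1 <= k < n) x ^+ k * drGamma (a * k%:R + b)).
  apply: cvg_trans L0; apply: near_eq_cvg; near=> h.
  have ha : `|h| < a / 2 by near: h; exact: dnbhs0_lt.
  have c1 : cvgn (fun n => \sum_(1 <= k < n) t k (h + a)) by apply: ct; rewrite addrK.
  have c2 : cvgn (fun n => \sum_(1 <= k < n) t k a) by apply: ct; rewrite subrr normr0.
  rewrite /= !EiE /GRing.scale /= mulr1; apply: cvg_lim => //.
  under eq_cvg do rewrite -mulr_sumr sumrB.
  by apply: cvgMr; apply: cvgB.
by apply: DeriveDef; [apply/cvg_ex; eexists; exact: L|exact: cvg_lim].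
Unshelve. all: end_near. Qed.

(** The function [a |-> - Q a y / Gamma a], extended continuously to the poles
    of [Gamma]. *)
Definition drGamma_series y a :=
  limn (fun n => \sum_(1 <= k < n) y ^+ k * drGamma (k%:R + a)).

Lemma is_cvg_drGamma_series y a :
  cvgn (fun n => \sum_(1 <= k < n) y ^+ k * drGamma (k%:R + a)).
Proof.
have [C hC] := decay_geometric_dominated y a (@drGamma_decay R) ltr01.
by apply: (@cvg_sum_geometric_dominated _ _ C) => k _; apply: hC; rewrite mul1r.
Qed.

Lemma continuous_drGamma_series y : continuous (drGamma_series y).
Proof.
move=> a; have [C hC] := decay_geometric_dominated y (a - 1) (@drGamma_decay R) ltr01.
apply: (@cvg_lim_sum_dominated _ _ (nbhs a) _ (fun k b => y ^+ k * drGamma (k%:R + b)) _ C).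
  move=> k _; apply: cvgMr; apply: continuous_comp; last exact: continuous_drGamma.
  by apply: cvgD; [exact: cvg_cst|exact: cvg_id].
near=> b => k _; apply: hC; rewrite mul1r lerD2l.
have : `|a - b| < 1 by near: b; exact: (@cvgr_dist_lt _ _ _ _ _ id a cvg_id 1 ltr01).
by rewrite ltr_norml => /andP[]; lra.
Unshelve. all: end_near. Qed.

Lemma Gamma_poleD a k : Gamma_pole (k%:R + a) -> Gamma_pole a.
Proof.
move=> /andP[aint ale]; have k0 : 0 <= k%:R :> R by [].
apply/andP; split; last lra.
by rewrite -(addKr k%:R a) addrC rpredB ?rpred_nat.
Qed.

(** Since [1 / Gamma a = (a)_k / Gamma (a + k)], dividing by [Gamma a] clears the
    Pochhammer symbols termwise.  The limits can be compared because
    [1 / Gamma a] does not vanish. *)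
Lemma Q_div_Gamma_nonpole y a : ~~ Gamma_pole a -> Q a y / Gamma a = - drGamma_series y a.
Proof.
move=> aP; have r0 := rGamma_neq0 aP.
have c := @is_cvg_drGamma_series y a.
rewrite /Q -[(Gamma a)^-1]/(rGamma a).
suff -> : limn (fun n => \sum_(1 <= k < n)
    y ^+ k / pochhammer a k * digamma (k%:R + a)) =
    - drGamma_series y a / rGamma a by rewrite divfK.
apply: cvg_lim => //.
have -> : (fun n => \sum_(1 <= k < n)
    y ^+ k / pochhammer a k * digamma (k%:R + a)) =
  (fun n => - (\sum_(1 <= k < n) y ^+ k * drGamma (k%:R + a)) / rGamma a).
  apply/funext => n; rewrite -sumrN mulr_suml; apply: eq_bigr => k _.
  have kP : ~~ Gamma_pole (k%:R + a) by apply: contraNN aP; exact: Gamma_poleD.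
  have := digamma_div_Gamma kP; rewrite -[(Gamma _)^-1]/(rGamma _) => dE.
  move: (r0); rewrite (rGamma_pochhammer a k) addrC mulf_eq0 negb_or => /andP[p0 g0].
  rewrite -mulrN -dE; field; exact/andP.
by apply: cvgMl; apply: cvgN.
Qed.

(** Poles are integers, hence isolated. *)
Lemma Gamma_pole_dnbhs a : Gamma_pole a -> \forall b \near a^', ~~ Gamma_pole b.
Proof.
move=> /andP[aint _]; near=> b.
have ba : b != a by near: b; exact: nbhs_dnbhs_neq.
have d : `|a - b| < 1.
  near: b; apply: cvg_within; exact: (@cvgr_dist_lt _ _ _ _ _ id a cvg_id 1 ltr01).
apply: contraNN ba => /andP[bint _].
have /intrP[m abm] := rpredB aint bint.
move: d; rewrite eq_sym -subr_eq0 abm -intr_norm -[1]/(1%:~R) ltr_int intr_eq0.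
lia.
Unshelve. all: end_near. Qed.

(** At a pole, the quotient agrees nearby with a continuous function. *)
Lemma Q_div_GammaE y a : Q_div_Gamma a y = - drGamma_series y a.
Proof.
rewrite /Q_div_Gamma; case: ifPn => [aP|]; last exact: Q_div_Gamma_nonpole.
apply: cvg_lim => //.
have c : - drGamma_series y b @[b --> a^'] --> - drGamma_series y a.
  apply: cvgN; apply: cvg_within_filter; exact: continuous_drGamma_series.
apply: cvg_trans c; apply: near_eq_cvg; near=> b.
rewrite Q_div_Gamma_nonpole//; near: b; exact: Gamma_pole_dnbhs.
Unshelve. all: end_near. Qed.

(** Each [m > 0] is [q * k - h] for exactly one [k > 0] and [h < q]. *)
Lemma sum_residues (c : nat -> R) q n : (0 < q)%N ->
  \sum_(1 <= m < (q * n).+1) c m =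
  \sum_(1 <= k < n.+1) \sum_(0 <= h < q) c (q * k - h)%N.
Proof.
move=> q0; elim: n => [|n IH]; first by rewrite muln0 !big_geq.
rewrite [RHS]big_nat_recr//= -IH (@big_cat_nat _ _ _ (q * n).+1)//=; last first.
  by rewrite ltnS leq_mul2l leqnSn orbT.
congr (_ + _); rewrite -[(q * n).+1]add0n big_addn big_nat_rev /= add0n.
rewrite mulnS subSS addnK; apply: eq_big_nat => h /andP[_ hq].
by congr c; lia.
Qed.

(** Truncating the [q] series on the left at a common index [n] gives the
    partial sum of the series on the right up to [q * n], by [sum_residues]. *)
Lemma sum_drGamma_series q x b : (1 <= q)%N -> x != 0 ->
  \sum_(0 <= h < q) x ^- h * drGamma_series (x ^+ q) (b - h%:R / q%:R) =
  limn (fun n => \sum_(1 <= k < n) x ^+ k * drGamma (q%:R^-1 * k%:R + b)).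
Proof.
move=> q1 x0; have qR0 : q%:R != 0 :> R by rewrite pnatr_eq0 -lt0n.
have qV0 : 0 < q%:R^-1 :> R by rewrite invr_gt0 ltr0n.
have [C hC] := decay_geometric_dominated x b (@drGamma_decay R) qV0.
pose c m := x ^+ m * drGamma (q%:R^-1 * m%:R + b).
have cc : cvgn (fun n => \sum_(1 <= k < n) c k).
  by apply: (@cvg_sum_geometric_dominated _ _ C) => k _; exact: hC.
pose V n := \sum_(0 <= h < q) x ^- h *
  \sum_(1 <= k < n.+1) (x ^+ q) ^+ k * drGamma (k%:R + (b - h%:R / q%:R)).
have VE n : V n = \sum_(1 <= m < (q * n).+1) c m.
  rewrite sum_residues// exchange_big /V /=; apply: eq_big_nat => h /andP[_ hq].
  rewrite mulr_sumr; apply: eq_big_nat => k /andP[k1 _].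
  have hqk : (h <= q * k)%N by rewrite (leq_trans (ltnW hq))// leq_pmulr.
  rewrite /c mulrA -exprM -{1}(subnK hqk) exprD mulrCA mulVf ?expf_neq0// mulr1.
  by congr (_ * drGamma _); rewrite natrB// natrM; field.
have Vlim : V n @[n --> \oo] -->
    \sum_(0 <= h < q) x ^- h * drGamma_series (x ^+ q) (b - h%:R / q%:R).
  apply: (cvg_big add_continuous) => h _; apply: cvgMr.
  rewrite (cvg_shiftS (fun n => \sum_(1 <= k < n) (x ^+ q) ^+ k *
    drGamma (k%:R + (b - h%:R / q%:R)))).
  exact: is_cvg_drGamma_series.
apply: (cvg_unique _ Vlim) => //.
rewrite /=; under eq_cvg do rewrite VE.
have sub : (fun n => (q * n).+1) @ \oo --> \oo.
  apply/cvgnyPge => A; near=> n; rewrite leqW// (@leq_trans n) ?leq_pmull//.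
  by near: n; exact: nbhs_infty_ge.
exact: (cvg_comp _ _ sub cc).
Unshelve. all: end_near. Qed.

End TermwiseDerivative.

Theorem theorem2p4 (R : realType) (q : nat) (beta x : R)
    (q_ge1 : (1 <= q)%N) (x_neq0 : x != 0) :
  is_derive (q%:R^-1 : R) 1 (fun alpha : R => Ei alpha beta x)
    (- \sum_(0 <= h < q)
        x ^- h * Q_div_Gamma (beta - h%:R / q%:R) (x ^+ q)).
Proof.
have qV0 : 0 < q%:R^-1 :> R by rewrite invr_gt0 ltr0n.
under eq_bigr do rewrite Q_div_GammaE mulrN.
rewrite sumrN opprK sum_drGamma_series//; exact: is_derive_Ei.
Qed.
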